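(* Let $(X_i)_{i \in J}$ be a family of topological spaces, let $Y$ be a Hausdorff space, and let $f : \prod_{i \in J} X_i \to Y$ be a continuous function (for the product topology) which is independent of any finite subset of the input, i.e. $f(x) = f(x')$ whenever $x, x' \in \prod_{i \in J} X_i$ differ in only finitely many coordinates. Then $f$ is constant, i.e. $f(x) = f(x')$ for all $x, x' \in \prod_{i\in J} X_i$.
   Context: $J$ is an arbitrary index set, and $\prod_{i \in J} X_i$ carries the product topology. *)

(* Defs.v *)
From mathcomp Require Import all_boot all_classical.
From mathcomp Require Import topology.

Set Implicit Arguments.
Unset Strict Implicit.
Unset Printing Implicit Defensive.

Local Open Scope classical_set_scope.

Definition independent_of_finite_subsets (J : Type) (X : J -> Type) (Y : Type)
    (f : (forall i, X i) -> Y) : Prop :=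
  forall x x' : forall i, X i,
    finite_set [set i | x i <> x' i] -> f x = f x'.

(* Main.v *)
Require Import Defs.
From mathcomp Require Import all_boot all_classical.
From mathcomp Require Import topology.

(** Fix x and x'.  A neighbourhood of x' in the product topology constrains
    only finitely many coordinates ([nbhs_prod_finite]), so it contains a point
    z that agrees with x' on those coordinates and with x on all the others.
    Since z differs from x in finitely many coordinates, f z = f x.  Hence
    every neighbourhood of f x' contains f x, by continuity of f at x', and
    the Hausdorff property forces f x = f x'. *)

(** The sets U in the conclusion form a filter.  The product topology is the
    supremum of the topologies induced by the projections, so it suffices that
    this filter converges to x for each of them; there a basic neighbourhood
    restricts the single coordinate that is projected onto. *)
Lemma nbhs_prod_finite (J : Type) (X : J -> topologicalType)
    (x : prod_topology X) (U : set (prod_topology X)) :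
  nbhs x U ->
  exists2 D : set J, finite_set D &
    forall y : prod_topology X, (forall i, D i -> y i = x i) -> U y.
Proof.
pose F : set_system (prod_topology X) := fun V => exists2 D, finite_set D &
  forall y : prod_topology X, (forall i, D i -> y i = x i) -> V y.
have filterF : Filter F.
  split=> [|V W [D finD DV] [E finE EW]|V W VW [D finD DV]].
  - by exists set0.
  - exists (D `|` E)%classic; first by rewrite finite_setU.
    by move=> y yx; split; [apply: DV | apply: EW] => i ?; apply: yx;
      [left | right].
  - by exists D => // y /DV; exact: VW.
suff Fx : (F --> x)%classic by exact: Fx.
apply/cvg_sup => i V [_ [[W _ <-] Wx WV]].
exists [set i]%classic; first exact: finite_set1.
by move=> y yx; apply: WV; rewrite /= yx.
Qed.

Theorem corollary6p5 (J : Type) (X : J -> topologicalType)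
    (Y : topologicalType) (hY : hausdorff_space Y)
    (f : prod_topology X -> Y) (fcont : continuous f)
    (findep : independent_of_finite_subsets f) :
  forall x x' : prod_topology X, f x = f x'.
Proof.
move=> x x'; apply: hY => A B Afx Bfx'.
have [D finD DB] := nbhs_prod_finite _ _ _ _ (fcont _ _ Bfx').
pose z : prod_topology X := fun i => if pselect (D i) then x' i else x i.
have zB : B (f z) by apply: DB => i Di; rewrite /z; case: pselect.
have fxz : f x = f z.
  apply: findep; apply: sub_finite_set finD => i /=.
  by rewrite /z; case: pselect.
by exists (f x); split; [exact: nbhs_singleton | rewrite fxz].
Qed.
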